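(* Let $A$ be a finite set, $\varphi\colon A^\omega\to\mathbb{R}$ be a continuous prefix-monotone shift-deterministic payoff and $G=\langle V,V_{\mathrm{Max}},V_{\mathrm{Min}},E\rangle$ be an $A$-labeled game graph. Take any $\mathbf{x}\in\varphi(A^\omega)^V$. Let $\mathcal{P}=e_1e_2e_3\ldots$ be an infinite path in $G$. Then there exists an infinite sequence of non-negative real numbers $\lambda_1,\lambda_2,\lambda_3,\ldots$ such that $\lambda_1=1$ and \[\varphi\big(\mathsf{lab}(\mathcal{P})\big)-\mathbf{x}_{\mathsf{source}(\mathcal{P})}=\sum_{n=1}^\infty\lambda_n\cdot R^{\mathbf{x}}(e_n),\] where the series is understood as the limit of its partial sums.
   Context: $A^*$ and $A^\omega$ denote the sets of finite and of infinite words over $A$. A payoff is a bounded function $A^\omega\to\mathbb{R}$. Continuity is with respect to the product topology on $A^\omega$ of the discrete topology on $A$. A payoff $\varphi$ is prefix-monotone if there are no $u,v\in A^*$ and $\beta,\gamma\in A^\omega$ with $\varphi(u\beta)>\varphi(u\gamma)$ and $\varphi(v\beta)<\varphi(v\gamma)$. It is shift-deterministic if $\varphi(\beta)=\varphi(\gamma)\implies\varphi(a\beta)=\varphi(a\gamma)$ for all $a\in A$, $\beta,\gamma\in A^\omega$. For a shift-deterministic payoff $\varphi$ and $a\in A$, $\mathbf{s}[a]\colon\varphi(A^\omega)\to\varphi(A^\omega)$ is the unique function with $\mathbf{s}[a](\varphi(\beta))=\varphi(a\beta)$ for all $\beta\in A^\omega$. An $A$-labeled game graph is a tuple $G=\langle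 V,V_{\mathrm{Max}},V_{\mathrm{Min}},E\rangle$ of finite sets such that $V$ is the disjoint union of $V_{\mathrm{Max}}$ and $V_{\mathrm{Min}}$, $E\subseteq V\times A\times V$, and for every $s\in V$ there exist $a\in A$, $t\in V$ with $(s,a,t)\in E$. For $e=(s,a,t)\in E$ put $\mathsf{source}(e)=s$, $\mathsf{lab}(e)=a$, $\mathsf{target}(e)=t$. An infinite path is an infinite sequence of edges $e_1e_2\ldots$ with $\mathsf{target}(e_i)=\mathsf{source}(e_{i+1})$ for all $i$; its source is $\mathsf{source}(e_1)$, and $\mathsf{lab}(\mathcal{P})=\mathsf{lab}(e_1)\mathsf{lab}(e_2)\ldots\in A^\omega$. For $\mathbf{x}\in\varphi(A^\omega)^V$, the modified cost of an edge $e\in E$ with respect to $\mathbf{x}$ is $R^{\mathbf{x}}(e)=\mathbf{s}[\mathsf{lab}(e)](\mathbf{x}_{\mathsf{target}(e)})-\mathbf{x}_{\mathsf{source}(e)}$. *)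

(* Defs.v *)
From mathcomp Require Import all_boot all_order all_algebra.
From mathcomp Require Import all_classical all_reals all_analysis.

Set Implicit Arguments.
Unset Strict Implicit.
Unset Printing Implicit Defensive.

Import Order.TTheory GRing.Theory Num.Theory.
Import numFieldNormedType.Exports.

Local Open Scope classical_set_scope.
Local Open Scope ring_scope.

(* [A^omega], with the product topology of the discrete topology on [A]. *)
Definition iword (A : finType) := {ptws nat -> discrete_topology A}.

Definition wcons (A : finType) (a : A) (w : iword A) : iword A :=
  fun n => if n is m.+1 then w m else a.

Definition wcat (A : finType) (u : seq A) (w : iword A) : iword A :=
  foldr (@wcons A) w u.

Definition payoff (A : finType) (R : realType) (phi : iword A -> R) : Prop :=
  [bounded phi w | w in [set: iword A]].

Definition prefix_monotone (A : finType) (R : realType)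
    (phi : iword A -> R) : Prop :=
  ~ exists (u v : seq A) (beta gamma : iword A),
      phi (wcat u beta) > phi (wcat u gamma) /\
      phi (wcat v beta) < phi (wcat v gamma).

Definition shift_deterministic (A : finType) (R : realType)
    (phi : iword A -> R) : Prop :=
  forall (a : A) (beta gamma : iword A),
    phi beta = phi gamma -> phi (wcons a beta) = phi (wcons a gamma).

Definition to_range (A : finType) (R : realType) (phi : iword A -> R)
    (w : iword A) : range phi :=
  SigSub (mem_set (imageT phi w)).

Lemma range_preimage (A : finType) (R : realType) (phi : iword A -> R)
    (y : range phi) : exists w, to_range phi w = y.
Proof.
case: y => y yP; have [w _ wy] := set_mem yP.
by exists w; apply: val_inj.
Qed.

(* [s[a]] is defined by choosing a preimage of its argument; for a
   shift-deterministic [phi] the choice is immaterial, and [shift_mapE] and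
   [shift_map_unique] say that [s[a]] is the unique function sending
   [phi beta] to [phi (a beta)]. *)
Definition shift_map (A : finType) (R : realType) (phi : iword A -> R)
    (a : A) (y : range phi) : range phi :=
  to_range phi (wcons a (projT1 (cid (range_preimage y)))).

Lemma shift_mapE (A : finType) (R : realType) (phi : iword A -> R) :
  shift_deterministic phi ->
  forall (a : A) (beta : iword A),
    shift_map a (to_range phi beta) = to_range phi (wcons a beta).
Proof.
move=> sd a beta; apply: val_inj; rewrite /shift_map /=.
by case: cid => w /= /(congr1 val) /= /sd.
Qed.

Lemma shift_map_unique (A : finType) (R : realType) (phi : iword A -> R)
    (a : A) (f : range phi -> range phi) :
  shift_deterministic phi ->
  (forall beta, f (to_range phi beta) = to_range phi (wcons a beta)) ->
  f = shift_map a.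
Proof.
move=> sd fE; apply/funext => y; have [w <-] := range_preimage y.
by rewrite fE shift_mapE.
Qed.

Record game_graph (A : finType) := GameGraph {
  vertex : finType;
  VMax : {set vertex};
  VMin : {set vertex};
  edges : {set vertex * A * vertex};
  VMax_VMin_cover : (VMax :|: VMin = [set: vertex])%SET;
  VMax_VMin_disjoint : (VMax :&: VMin = finset.set0)%SET;
  out_edge : forall s : vertex, exists (a : A) (t : vertex),
    (s, a, t) \in edges
}.

Section Edges.
Variables (A : finType) (G : game_graph A).

Definition edge := {e : vertex G * A * vertex G | e \in edges G}.

Definition source (e : edge) : vertex G := (val e).1.1.
Definition lab (e : edge) : A := (val e).1.2.
Definition target (e : edge) : vertex G := (val e).2.

(* Paths are indexed from 0: [P n] is the edge e_(n+1). *)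
Definition infinite_path (P : nat -> edge) : Prop :=
  forall n, target (P n) = source (P n.+1).

Definition path_source (P : nat -> edge) : vertex G := source (P 0%N).

Definition path_lab (P : nat -> edge) : iword A := fun n => lab (P n).

Definition modified_cost (R : realType) (phi : iword A -> R)
    (x : vertex G -> range phi) (e : edge) : R :=
  val (shift_map (lab e) (x (target e))) - val (x (source e)).

End Edges.

(* Main.v *)
Require Import Defs.
From mathcomp Require Import all_boot all_order all_algebra.
From mathcomp Require Import all_classical all_reals all_analysis.

Import Order.TTheory GRing.Theory Num.Theory.
Import numFieldNormedType.Exports.

Local Open Scope classical_set_scope.
Local Open Scope ring_scope.

(* Let [w_v] be an infinite word with [phi w_v = x_v], and let [z_n] be the
   value of the first [n] labels of the path followed by [w_v], [v] being the
   [n]-th vertex. Then [z_0 = x_(source P)], and [z_n] tends to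
   [phi (lab P)] by continuity. Prefixing the first [n] labels to the two words
   whose values differ by [R^x(e_n)] gives two words whose values differ by
   [z_n.+1 - z_n]: by prefix-monotonicity and shift-determinism this is a
   nonnegative multiple of [R^x(e_n)], so the series telescopes. *)

Lemma wcat_rcons (A : finType) (u : seq A) (a : A) (w : iword A) :
  wcat (rcons u a) w = wcat u (wcons a w).
Proof. exact: foldr_rcons. Qed.

Lemma nth_wcat (A : finType) (u : seq A) (w : iword A) (a0 : A) (n : nat) :
  (n < size u)%N -> wcat u w n = nth a0 u n.
Proof. by elim: u n => [|a u IHu] [|n] //=; exact: IHu. Qed.

(** Convergence is coordinatewise, and coordinate [m] equals [w m] once [n > m], whatever the tails
    [v n]. *)
Lemma cvg_wcat_mkseq (A : finType) (w : iword A) (v : nat -> iword A) :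
  (fun n => wcat (mkseq w n) (v n)) @ \oo --> w.
Proof.
apply/pointwise_cvgP => m; apply/discrete_cvg.
exists m.+1 => // n /= ltmn.
by rewrite (nth_wcat A _ _ (w m)) ?size_mkseq ?nth_mkseq.
Qed.

Section ShiftDeterministic.
Variables (R : realType) (A : finType) (phi : iword A -> R).
Hypothesis phi_shift : shift_deterministic phi.

Lemma shift_deterministic_wcat (u : seq A) (beta gamma : iword A) :
  phi beta = phi gamma -> phi (wcat u beta) = phi (wcat u gamma).
Proof. by move=> eq_phi; elim: u => //= a u; exact: phi_shift. Qed.

Hypothesis phi_monotone : prefix_monotone phi.

(** Comparing the prefix [u] with the empty prefix shows that numerator and denominator never have
    opposite signs. *)
Lemma prefix_ratio_ge0 (u : seq A) (beta gamma : iword A) :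
  0 <= (phi (wcat u beta) - phi (wcat u gamma)) / (phi beta - phi gamma).
Proof.
have mono b c : phi b < phi c -> phi (wcat u b) <= phi (wcat u c).
  move=> ltbc; rewrite leNgt; apply/negP => ltcb.
  by apply: phi_monotone; exists u, [::], b, c.
have [lt|lt|->] := ltgtP (phi beta) (phi gamma).
- by rewrite mulr_le0 ?invr_le0 ?subr_le0 ?mono // ltW.
- by rewrite divr_ge0 ?subr_ge0 ?mono // ltW.
- by rewrite subrr invr0 mulr0.
Qed.

(* When [phi beta = phi gamma] the ratio is [0], as division by [0] gives [0]. *)
Lemma prefix_ratioK (u : seq A) (beta gamma : iword A) :
  (phi (wcat u beta) - phi (wcat u gamma)) / (phi beta - phi gamma)
    * (phi beta - phi gamma) = phi (wcat u beta) - phi (wcat u gamma).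
Proof.
have [/eqP|neq0] := eqVneq (phi beta - phi gamma) 0; last by rewrite divfK.
rewrite subr_eq0 => /eqP eq_phi.
by rewrite (shift_deterministic_wcat u _ _ eq_phi) subrr !mul0r.
Qed.

End ShiftDeterministic.

Theorem lemma7p4 (R : realType) (A : finType) (phi : iword A -> R)
    (phi_payoff : payoff phi)
    (phi_continuous : continuous phi)
    (phi_monotone : prefix_monotone phi)
    (phi_shift : shift_deterministic phi)
    (G : game_graph A) (x : vertex G -> range phi)
    (P : nat -> edge G) (P_path : infinite_path P) :
  exists lambda : nat -> R,
    [/\ forall n, 0 <= lambda n,
        lambda 0%N = 1 &
        (fun N => \sum_(0 <= n < N) lambda n * modified_cost x (P n)) @ \oo
          --> phi (path_lab P) - val (x (path_source P))].
Proof.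
have [w wE] := choice (fun v => range_preimage (x v)).
have phi_w v : val (x v) = phi (w v) by rewrite -wE.
pose tl n := w (source (P n)).
pose u n := mkseq (path_lab P) n.
pose beta n := wcons (lab (P n)) (tl n.+1).
pose z n := phi (wcat (u n) (tl n)).
have zS n : z n.+1 = phi (wcat (u n) (beta n)).
  by rewrite /z /u mkseqS wcat_rcons.
have costE n : modified_cost x (P n) = phi (beta n) - phi (tl n).
  by rewrite /modified_cost phi_w P_path -wE shift_mapE.
(* When the first cost vanishes the ratio at [0] would be [0], so [1] is imposed there. As [u 0] is
   empty, the first cost is [z 1 - z 0] anyway. *)
pose lambda n : R :=
  if n is 0%N then 1 else (z n.+1 - z n) / (phi (beta n) - phi (tl n)).
have termE n : lambda n * modified_cost x (P n) = z n.+1 - z n.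
  rewrite costE zS; case: n => [|n]; first by rewrite mul1r.
  by rewrite /lambda zS prefix_ratioK.
exists lambda; split => // [[|n]|] //.
  by rewrite /lambda zS prefix_ratio_ge0.
have sumE N : \sum_(0 <= n < N) lambda n * modified_cost x (P n) = z N - z 0%N.
  by rewrite (eq_bigr _ (fun n _ => termE n)) telescope_sumr.
(* [z 0] computes to [phi (w (path_source P))], so only the limit of [z] remains. *)
rewrite phi_w (funext sumE); apply: cvgB; last exact: cvg_cst.
apply: continuous_cvg; first exact: phi_continuous.
exact: cvg_wcat_mkseq.
Qed.
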